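(* Let $\mathbb{F}$ be a finite field, let $\mathbf{C}\subseteq\mathbb{F}((D))^n$ be an $(n,k)$ convolutional code over $\mathbb{F}$, and let $G$ be a generating matrix of $\mathbf{C}$. Let $\Sigma_G$ be the encoding state space of $G$ and $\Sigma_{\mathbf{C}}$ the code state space of $\mathbf{C}$. Then $$\mathcal{G}:\Sigma_G\to\Sigma_{\mathbf{C}},\qquad [u]_G\mapsto[uG]_{\mathbf{C}}$$ is a well-defined $\mathbb{F}$-linear mapping, and $$\dim_{\mathbb{F}}\Sigma_{\mathbf{C}}\le\dim_{\mathbb{F}}\Sigma_G .$$ Moreover, if $\mathcal{G}$ is injective, then $G$ is minimal.
   Context: Vectors are row vectors. $\mathbb{F}((D))$ is the field of formal Laurent series over $\mathbb{F}$ in $D$ (finitely many negative powers), and $\mathbb{F}(D)\subset\mathbb{F}((D))$ is the subfield of rational series. A series is *causal* if it lies in $\mathbb{F}[[D]]$. For $u=\sum_j u_jD^j\in\mathbb{F}((D))$ put $\mathcal{Q}(u)=\sum_{j\ge0}u_jD^j$ (causal part) and $\mathcal{P}(u)=\sum_{j<0}u_jD^j$ (anticausal part). Both are applied componentwise to vectors. An *$(n,k)$ convolutional code* is a $k$-dimensional $\mathbb{F}((D))$-subspace $\mathbf{C}$ of $\mathbb{F}((D))^n$ that has a basis consisting of vectors in $\mathbb{F}(D)^n$. A *generating matrix* of $\mathbf{C}$ is a $k\times n$ matrix $G$ of rank $k$ whose entries are causal rational series and whose rows generate $\mathbf{C}$ over $\mathbb{F}((D))$. **Encoding state space.** This is the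 quotient of vector spaces over $\mathbb{F}$ $$\Sigma_G=\mathbb{F}((D))^k/\mathcal{S}^*_G,\qquad \mathcal{S}^*_G=\{u\in\mathbb{F}((D))^k\mid\mathcal{Q}(\mathcal{P}(u)G)=0\},$$ with elements $[u]_G=u+\mathcal{S}^*_G$. **Code state space.** This is the quotient of vector spaces over $\mathbb{F}$ $$\Sigma_{\mathbf{C}}=\mathbf{C}/\mathbf{C}^*,\qquad \mathbf{C}^*=\{v\in\mathbf{C}\mid\mathcal{Q}(v)\in\mathbf{C}\},$$ with elements $[v]_{\mathbf{C}}=v+\mathbf{C}^*$. A generating matrix $G$ of $\mathbf{C}$ is *minimal* if $\dim_{\mathbb{F}}\Sigma_G$ is the smallest possible among all generating matrices of the same code $\mathbf{C}$. *)

(* Defs.v *)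
From HB Require Import structures.
From mathcomp Require Import all_boot all_order all_algebra generic_quotient ring_quotient.
From mathcomp Require Import zify.
From mathcomp Require Import boolp classical_sets functions cardinality fsbigop.
Set Implicit Arguments.
Unset Strict Implicit.
Unset Printing Implicit Defensive.
Import Order.TTheory GRing.Theory Num.Theory.
Local Open Scope ring_scope.
Local Open Scope quotient_scope.

Section LaurentField.
Variable F : fieldType.

Definition bounded_below : {pred int -> F} :=
  fun f => `[< exists m : int, forall j, j < m -> f j = 0 >].

Lemma bounded_below_zmod_closed : zmod_closed bounded_below.
Proof.
split; first by apply/asboolP; exists 0.
move=> f g /asboolP[m fm] /asboolP[p gp]; apply/asboolP; exists (Num.min m p) => j.
rewrite lt_min => /andP[jm jp].
by rewrite -[LHS]/(f j - g j) fm// gp// subr0.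
Qed.
HB.instance Definition _ :=
  GRing.isZmodClosed.Build (int -> F) bounded_below bounded_below_zmod_closed.

Record laurent := Laurent {
  lcoef :> int -> F;
  lcoefP : lcoef \in bounded_below }.

HB.instance Definition _ := [isSub for lcoef].
HB.instance Definition _ := [Choice of laurent by <:].
HB.instance Definition _ := [SubChoice_isSubZmodule of laurent by <:].

Implicit Types u v w : laurent.

Lemma laurentP u v : (forall j, u j = v j) -> u = v.
Proof. by move=> uv; apply/val_inj/funext. Qed.

Lemma laurent_lb u : exists m : int, forall j, j < m -> u j = 0.
Proof. exact/asboolP/(lcoefP u). Qed.

Lemma lcoefD u v j : (u + v) j = u j + v j.
Proof. by rewrite -[lcoef _]/(val (u + v)) raddfD. Qed.
Lemma lcoefN u j : (- u) j = - u j.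
Proof. by rewrite -[lcoef _]/(val (- u)) raddfN. Qed.
Lemma lcoef0 j : (0 : laurent) j = 0.
Proof. by rewrite -[lcoef _]/(val (0 : laurent)) raddf0. Qed.

(* The sum is finitely supported: only finitely many i contribute. *)
Definition conv (f g : int -> F) : int -> F :=
  fun n => \sum_(i \in [set: int]) f i * g (n - i).

Lemma conv_window f g (a b : int) (k : nat) :
    (forall j, j < a -> f j = 0) -> (forall j, j < b -> g j = 0) ->
  conv f g (a + b + k%:Z) = \sum_(j < k.+1) f (a + j%:Z) * g (b + (k - j)%N%:Z).
Proof.
move=> fa gb; rewrite /conv.
pose h (j : nat) : int := a + j%:Z.
have inj_h : injective h by move=> x y; rewrite /h; lia.
rewrite (@fsbigE _ _ _ _ _ [seq h j | j <- iota 0 k.+1]) ?map_inj_uniq ?iota_uniq//.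
  rewrite (eq_bigl xpredT); last by move=> i; rewrite in_setT.
  rewrite big_map -[RHS](big_mkord xpredT
    (fun j : nat => f (a + j%:Z) * g (b + (k - j)%N%:Z))).
  rewrite /index_iota subn0 [LHS]big_seq_cond [RHS]big_seq_cond.
  apply: eq_bigr => j; rewrite mem_iota => jk; congr (_ * g _); rewrite /h; lia.
move=> i _ ni.
have [ia|ia] := ltP i a; first by rewrite fa ?mul0r.
have [ib|ib] := ltP (a + b + k - i) b; first by rewrite gb ?mulr0.
case/negP: ni; apply/mapP; exists `|i - a|%N; rewrite ?mem_iota /h; lia.
Qed.

Lemma conv_low f g (a b n : int) :
    (forall j, j < a -> f j = 0) -> (forall j, j < b -> g j = 0) ->
  n < a + b -> conv f g n = 0.
Proof.
move=> fa gb nab; rewrite /conv fsbig1// => i _.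
have [ia|ia] := ltP i a; first by rewrite fa ?mul0r.
by rewrite gb ?mulr0//; lia.
Qed.

Lemma conv_bounded u v : conv u v \in bounded_below.
Proof.
have [a ua] := laurent_lb u; have [b vb] := laurent_lb v.
by apply/asboolP; exists (a + b) => j; apply: conv_low.
Qed.
Definition lmul u v : laurent := Laurent (conv_bounded u v).

Definition poly_coef (p : {poly F}) (j : int) : F := if j is Posz i then p`_i else 0.
Lemma poly_coef_bounded p : poly_coef p \in bounded_below.
Proof. by apply/asboolP; exists 0 => -[]. Qed.
Definition laurent_of_poly (p : {poly F}) : laurent := Laurent (poly_coef_bounded p).

Definition lone : laurent := laurent_of_poly 1.

Let lb_ u : {m : int | forall j, j < m -> u j = 0} := cid (laurent_lb u).
Let trunc u (a : int) (N : nat) : {poly F} := \poly_(i < N) u (a + i%:Z).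

Let lmul_trunc u v (a b : int) (k N : nat) :
    (forall j, j < a -> u j = 0) -> (forall j, j < b -> v j = 0) -> (k < N)%N ->
  lmul u v (a + b + k%:Z) = (trunc u a N * trunc v b N)`_k.
Proof.
move=> ua vb kN; rewrite [LHS](conv_window _ ua vb) coefM; apply: eq_bigr => j _.
have jk := ltn_ord j; rewrite !coef_poly !ifT//; lia.
Qed.

Let lmul_low u v (a b n : int) :
    (forall j, j < a -> u j = 0) -> (forall j, j < b -> v j = 0) ->
  n < a + b -> lmul u v n = 0.
Proof. exact: conv_low. Qed.

Lemma lmulC : commutative lmul.
Proof.
move=> u v; apply: laurentP => n; have [a ua] := lb_ u; have [b vb] := lb_ v.
have [nab|nab] := ltP n (a + b); first by rewrite !(lmul_low ua vb, lmul_low vb ua)//; lia.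
have [k ->] : exists k : nat, n = a + b + k%:Z by exists (absz (n - (a + b))%R); lia.
by rewrite (lmul_trunc ua vb (ltnSn k)) (addrC a b) (lmul_trunc vb ua (ltnSn k)) mulrC.
Qed.

Lemma lmulDl : left_distributive lmul +%R.
Proof.
move=> u v w; apply: laurentP => n.
have [a' ua] := lb_ u; have [b' vb] := lb_ v; have [c wc] := lb_ w.
pose a := Num.min a' b'.
have {}ua j : j < a -> u j = 0 by rewrite lt_min => /andP[/ua].
have {}vb j : j < a -> v j = 0 by rewrite lt_min => /andP[_ /vb].
have uva j : j < a -> (u + v) j = 0 by move=> ja; rewrite lcoefD ua// vb// addr0.
rewrite lcoefD.
have [nab|nab] := ltP n (a + c).
  by rewrite (lmul_low uva wc)// (lmul_low ua wc)// (lmul_low vb wc)// addr0.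
have [k ->] : exists k : nat, n = a + c + k%:Z by exists (absz (n - (a + c))%R); lia.
rewrite (lmul_trunc uva wc (ltnSn k)) (lmul_trunc ua wc (ltnSn k)).
rewrite (lmul_trunc vb wc (ltnSn k)) -coefD -mulrDl.
suff -> : trunc (u + v) a k.+1 = trunc u a k.+1 + trunc v a k.+1 by [].
by apply/polyP => i; rewrite coefD !coef_poly; case: ifP; rewrite ?addr0 ?lcoefD.
Qed.

Lemma lmul1 : left_id lone lmul.
Proof.
move=> u; apply: laurentP => n; have [a ua] := lb_ u.
have o0 j : j < 0 -> lone j = 0 by case: j.
have [na|na] := ltP n a; first by rewrite (lmul_low o0 ua) ?ua// add0r.
have [k ->] : exists k : nat, n = 0 + a + k%:Z by exists (absz (n - a)%R); lia.
rewrite (lmul_trunc o0 ua (ltnSn k)).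
have -> : trunc lone 0 k.+1 = 1.
  apply/polyP => i; rewrite coef_poly add0r /= coef1; case: ifP => //.
  by case: i.
by rewrite mul1r coef_poly ltnSn add0r.
Qed.

Lemma lmulA : associative lmul.
Proof.
move=> u v w; apply: laurentP => n.
have [a ua] := lb_ u; have [b vb] := lb_ v; have [c wc] := lb_ w.
have uvab j : j < a + b -> lmul u v j = 0 by apply: lmul_low.
have vwbc j : j < b + c -> lmul v w j = 0 by apply: lmul_low.
have [nab|nab] := ltP n (a + b + c).
  by rewrite (lmul_low uvab wc)// (lmul_low ua vwbc)// addrA.
have [k ->] : exists k : nat, n = a + (b + c) + k%:Z by exists (absz (n - (a + b + c))%R); lia.
pose p := trunc u a k.+1; pose q := trunc v b k.+1; pose r := trunc w c k.+1.
transitivity ((p * (q * r))`_k).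
  rewrite (lmul_trunc ua vwbc (ltnSn k)) !coefM; apply: eq_bigr => j _; congr (_ * _).
  by rewrite coef_poly ifT ?(lmul_trunc vb wc (N := k.+1))//; lia.
rewrite mulrA (addrA a b c) (lmul_trunc uvab wc (ltnSn k)) !coefM.
apply: eq_bigr => j _; congr (_ * _).
by rewrite coef_poly ltn_ord (lmul_trunc ua vb (N := k.+1)).
Qed.

Lemma lone_neq0 : lone != 0.
Proof.
apply/eqP => /(congr1 (fun u : laurent => u 0)).
by rewrite lcoef0 /= coef1 => /eqP; rewrite oner_eq0.
Qed.

HB.instance Definition _ :=
  GRing.Zmodule_isComNzRing.Build laurent lmulA lmulC lmul1 lmulDl lone_neq0.

Lemma scale_bounded (a : F) u : (fun j => a * u j) \in bounded_below.
Proof.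
have [m um] := laurent_lb u; apply/asboolP; exists m => j /um ->.
by rewrite mulr0.
Qed.
Definition lscale (a : F) u : laurent := Laurent (scale_bounded a u).

Lemma lscaleA a b u : lscale a (lscale b u) = lscale (a * b) u.
Proof. by apply: laurentP => j; rewrite /= mulrA. Qed.
Lemma lscale1 : left_id 1 lscale.
Proof. by move=> u; apply: laurentP => j; rewrite /= mul1r. Qed.
Lemma lscaleDr : right_distributive lscale +%R.
Proof. by move=> a u v; apply: laurentP => j; rewrite -[LHS]/(a * (u + v) j) !lcoefD mulrDr. Qed.
Lemma lscaleDl u : {morph lscale^~ u : a b / a + b}.
Proof. by move=> a b; apply: laurentP => j; rewrite lcoefD -[LHS]/((a + b) * u j) mulrDl. Qed.
HB.instance Definition _ := GRing.Zmodule_isLmodule.Build F laurent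
  lscaleA lscale1 lscaleDr lscaleDl.

Lemma lscaleAl (a : F) u v : a *: (u * v) = (a *: u) * v.
Proof.
apply: laurentP => n; rewrite -[LHS]/(a * conv u v n) -[RHS]/(conv (a *: u) v n).
by rewrite /conv mulr_fsumr; apply: eq_fsbigr => i _; rewrite mulrA.
Qed.
HB.instance Definition _ := GRing.Lmodule_isLalgebra.Build F laurent lscaleAl.
HB.instance Definition _ := GRing.Lalgebra_isComAlgebra.Build F laurent.

Definition linv u : laurent := xget 0 [set v | v * u = 1].

Section InverseSeries.
Variable p : nat -> F.
Fixpoint inv_seq (k : nat) : seq F :=
  if k is k'.+1 then
    let s := inv_seq k' in
    rcons s ((p 0)^-1 * ((k' == 0%N)%:R - \sum_(j < k') s`_j * p (k' - j)%N))
  else [::].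

Lemma size_inv_seq k : size (inv_seq k) = k.
Proof. by elim: k => //= k IH; rewrite size_rcons IH. Qed.

Lemma nth_inv_seq k i : (i < k)%N -> (inv_seq k)`_i = (inv_seq i.+1)`_i.
Proof.
elim: k => // k IH; rewrite ltnS leq_eqVlt => /orP[/eqP->//|ik].
by rewrite [in LHS]/= nth_rcons size_inv_seq ik IH.
Qed.

Lemma inv_seqP k : p 0 != 0 ->
  \sum_(j < k.+1) (inv_seq j.+1)`_j * p (k - j)%N = (k == 0%N)%:R.
Proof.
move=> p0; rewrite big_ord_recr subnn /= nth_rcons size_inv_seq ltnn eqxx.
rewrite mulrAC mulVf// mul1r addrC.
under [X in _ - X]eq_bigr => j _ do rewrite nth_inv_seq//.
by rewrite subrK.
Qed.
End InverseSeries.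

Lemma laurent_inv_ex u : u != 0 -> exists v, v * u = 1.
Proof.
move=> u0; have [a ua] := laurent_lb u.
have ex : exists i : nat, u (a + i%:Z) != 0.
  apply: contrapT => /forallNP nu; case/eqP: u0; apply: laurentP => j.
  rewrite lcoef0; have [/ua//|aj] := ltP j a.
  have := nu `|j - a|%N; rewrite (_ : a + _ = j); last lia.
  by move=> /negP; rewrite negbK => /eqP.
pose d := ex_minn ex; pose m := a + d%:Z.
have um0 : u m != 0 by rewrite /m /d; case: ex_minnP.
have um j : j < m -> u j = 0.
  move=> jm; have [/ua//|aj] := ltP j a; apply/eqP/negPn/negP => uj.
  move: jm; rewrite /m /d; case: ex_minnP => e _ /(_ `|j - a|%N).
  rewrite (_ : a + `|j - a|%N = j); last lia.
  by move=> /(_ uj); lia.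
pose p (i : nat) := u (m + i%:Z).
pose q (j : int) : F := if j + m is Posz i then (inv_seq p i.+1)`_i else 0.
have qm j : j < - m -> q j = 0 by rewrite /q; case E : (j + m) => //; lia.
have qb : q \in bounded_below by apply/asboolP; exists (- m).
exists (Laurent qb); apply: laurentP => n.
rewrite -[LHS]/(conv q u n).
have [n0|n0] := ltP n 0.
  by rewrite (conv_low qm um) ?addNr//; case: n n0.
have [k ->] : exists k : nat, n = - m + m + k%:Z by exists (absz (n)%R); lia.
rewrite conv_window// addNr add0r.
rewrite -[RHS]/((1 : {poly F})`_k) coef1 -(@inv_seqP p) ?/p ?addr0//.
by apply: eq_bigr => j _; rewrite /q addrAC addNr add0r.
Qed.

Lemma linv_mul u : u != 0 -> linv u * u = 1.
Proof.
by move=> /laurent_inv_ex[v vu]; rewrite /linv; case: xgetP => [w _ ->//|/(_ v)/(_ vu)].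
Qed.

Lemma linv0 : linv 0 = 0.
Proof.
rewrite /linv; case: xgetP => // v _ /eqP.
by rewrite mulr0 eq_sym oner_eq0.
Qed.

HB.instance Definition _ := GRing.ComNzRing_isField.Build laurent linv_mul linv0.
End LaurentField.

(* An L-vector space, L = F((D)), seen as a vector space over F. *)
Section RestrictScalars.
Variables (F : fieldType) (V : lmodType (laurent F)).
Definition restrict_scalars : Type := V.
HB.instance Definition _ := GRing.Zmodule.on restrict_scalars.

Definition restrict_scale (a : F) (v : restrict_scalars) : restrict_scalars :=
  (a%:A : laurent F) *: (v : V).
Lemma restrict_scaleA a b v :
  restrict_scale a (restrict_scale b v) = restrict_scale (a * b) v.
Proof. by rewrite /restrict_scale scalerA mulr_algl scalerA. Qed.
Lemma restrict_scale1 : left_id 1 restrict_scale.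
Proof. by move=> v; rewrite /restrict_scale !scale1r. Qed.
Lemma restrict_scaleDr : right_distributive restrict_scale +%R.
Proof. by move=> a u v; apply: (@scalerDr _ V). Qed.
Lemma restrict_scaleDl v : {morph restrict_scale^~ v : a b / a + b}.
Proof. by move=> a b; rewrite /restrict_scale scalerDl scalerDl. Qed.
HB.instance Definition _ := GRing.Zmodule_isLmodule.Build F restrict_scalars
  restrict_scaleA restrict_scale1 restrict_scaleDr restrict_scaleDl.
End RestrictScalars.

Section LmodQuotient.
Variables (R : nzRingType) (V : lmodType R) (S : {pred V}).
Hypothesis S_submod : submod_closed S.

HB.instance Definition _ := GRing.isZmodClosed.Build V S (GRing.submod_closedB S_submod).
Definition lmod_quot : Type := Quotient.quot S.
Local Notation Q := lmod_quot.
HB.instance Definition _ := GRing.Zmodule.on Q.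
HB.instance Definition _ := EqQuotient.on Q.

Definition quot_class (v : V) : Q := \pi_Q v.

Definition quot_scale (a : R) (x : Q) : Q := quot_class (a *: repr x).

Lemma quot_class_is_zmod : zmod_morphism quot_class.
Proof. exact: (@pi_is_zmod_morphism _ _ _ (Quotient.quot S)). Qed.
HB.instance Definition _ := GRing.isZmodMorphism.Build V Q quot_class quot_class_is_zmod.

Lemma quot_class_eq u v : (quot_class u = quot_class v) <-> (u - v \in S).
Proof. by rewrite Quotient.idealrBE; split => [/eqP|/eqP]. Qed.

Lemma quot_class_surj x : exists v, quot_class v = x.
Proof. by exists (repr x); exact: reprK. Qed.

Lemma scale_quot_class a (v : V) : quot_scale a (quot_class v) = quot_class (a *: v).
Proof.
apply/quot_class_eq; rewrite -scalerBr; apply: (GRing.subsemimod_closedZ (GRing.submod_closed_semi S_submod)).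
by apply/quot_class_eq; exact: reprK.
Qed.

Lemma quot_scaleA a b x : quot_scale a (quot_scale b x) = quot_scale (a * b) x.
Proof. by have [v <-] := quot_class_surj x; rewrite !scale_quot_class scalerA. Qed.
Lemma quot_scale1 : left_id 1 quot_scale.
Proof. by move=> x; have [v <-] := quot_class_surj x; rewrite scale_quot_class scale1r. Qed.
Lemma quot_scaleDr : right_distributive quot_scale +%R.
Proof.
move=> a x y; have [u <-] := quot_class_surj x; have [v <-] := quot_class_surj y.
by rewrite -raddfD !scale_quot_class -raddfD scalerDr.
Qed.
Lemma quot_scaleDl x : {morph quot_scale^~ x : a b / a + b}.
Proof.
by move=> a b; have [v <-] := quot_class_surj x; rewrite !scale_quot_class scalerDl raddfD.
Qed.
HB.instance Definition _ := GRing.Zmodule_isLmodule.Build R Q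
  quot_scaleA quot_scale1 quot_scaleDr quot_scaleDl.

Lemma quot_class_scalable : scalable quot_class.
Proof. by move=> a v; rewrite -scale_quot_class. Qed.
HB.instance Definition _ := GRing.isScalable.Build R V Q *:%R quot_class quot_class_scalable.
End LmodQuotient.

Section Dimension.
Variable K : fieldType.

(* The families are arbitrary subsets: the space may be infinite-dimensional. *)
Definition lin_indep (V : lmodType K) (B : set V) :=
  forall (s : seq V) (c : V -> K), uniq s -> (forall v, v \in s -> B v) ->
    \sum_(v <- s) c v *: v = 0 -> forall v, v \in s -> c v = 0.

Definition spanning (V : lmodType K) (B : set V) :=
  forall w : V, exists (s : seq V) (c : V -> K),
    (forall v, v \in s -> B v) /\ w = \sum_(v <- s) c v *: v.

Definition is_basis (V : lmodType K) (B : set V) := lin_indep B /\ spanning B.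

(* dim V <= dim W, dimensions being the cardinalities of bases. *)
Definition dim_le (V W : lmodType K) :=
  exists (B : set V) (B' : set W), [/\ is_basis B, is_basis B' & (B #<= B')%card].
End Dimension.

Section Codes.
Variable F : fieldType.
Local Notation L := (laurent F).

Definition causal (u : L) := forall j : int, j < 0 -> u j = 0.

Definition rational (u : L) :=
  exists p q : {poly F}, q != 0 /\ u = laurent_of_poly p / laurent_of_poly q.

Lemma causal_part_bounded (u : L) :
  (fun j : int => if 0 <= j then u j else 0) \in @bounded_below F.
Proof. by apply/asboolP; exists 0 => j j0; rewrite leNgt j0. Qed.
Definition causal_part (u : L) : L := Laurent (causal_part_bounded u).

Lemma anticausal_part_bounded (u : L) :
  (fun j : int => if j < 0 then u j else 0) \in @bounded_below F.
Proof.
by have [m um] := laurent_lb u; apply/asboolP; exists m => j /um ->; case: ifP.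
Qed.
Definition anticausal_part (u : L) : L := Laurent (anticausal_part_bounded u).

Definition vcausal_part {n} (v : 'rV[L]_n) : 'rV[L]_n := map_mx causal_part v.
Definition vanticausal_part {n} (v : 'rV[L]_n) : 'rV[L]_n := map_mx anticausal_part v.

Lemma vcausal_part_lin n (a : F) (u v : 'rV[L]_n) :
  vcausal_part (a%:A *: u + v) = a%:A *: vcausal_part u + vcausal_part v.
Proof.
apply/rowP => i; rewrite !mxE !mulr_algl; apply: laurentP => j.
rewrite -[LHS]/(if 0 <= j then (a *: u 0 i + v 0 i) j else 0) !lcoefD.
rewrite -[RHS]/(a * (if 0 <= j then u 0 i j else 0) + (if 0 <= j then v 0 i j else 0)).
by case: ifP; rewrite ?mulr0 ?addr0.
Qed.
Lemma vanticausal_part_lin n (a : F) (u v : 'rV[L]_n) :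
  vanticausal_part (a%:A *: u + v) = a%:A *: vanticausal_part u + vanticausal_part v.
Proof.
apply/rowP => i; rewrite !mxE !mulr_algl; apply: laurentP => j.
rewrite -[LHS]/(if j < 0 then (a *: u 0 i + v 0 i) j else 0) !lcoefD.
rewrite -[RHS]/(a * (if j < 0 then u 0 i j else 0) + (if j < 0 then v 0 i j else 0)).
by case: ifP; rewrite ?mulr0 ?addr0.
Qed.
Lemma vcausal_part0 n : vcausal_part (0 : 'rV[L]_n) = 0.
Proof. by apply/rowP => i; rewrite !mxE; apply: laurentP => j; rewrite lcoef0; apply: if_same. Qed.
Lemma vanticausal_part0 n : vanticausal_part (0 : 'rV[L]_n) = 0.
Proof. by apply/rowP => i; rewrite !mxE; apply: laurentP => j; rewrite lcoef0; apply: if_same. Qed.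

Definition is_conv_code (n k : nat) (C : {vspace 'rV[L]_n}) :=
  \dim C = k /\
  exists X : k.-tuple 'rV[L]_n,
    basis_of C X /\ forall i j, rational (tnth X i 0 j).

Definition generating (n k : nat) (C : {vspace 'rV[L]_n}) (G : 'M[L]_(k, n)) :=
  [/\ \rank G = k,
      forall i j, causal (G i j) /\ rational (G i j) &
      <<[seq row i G | i : 'I_k]>>%VS = C].

Section EncodingStateSpace.
Variables (n k : nat) (G : 'M[L]_(k, n)).
Local Notation U := (restrict_scalars 'rV[L]_k).

(* The subspace S*_G of the encoding state space Sigma_G = L^k / S*_G. *)
Definition enc_null : {pred U} :=
  fun u : 'rV[L]_k => vcausal_part (vanticausal_part u *m G) == 0.

Lemma enc_null_submod : submod_closed enc_null.
Proof.
split; first by rewrite unfold_in /= vanticausal_part0 mul0mx vcausal_part0.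
move=> a u v; rewrite !unfold_in => /eqP u0 /eqP v0.
rewrite vanticausal_part_lin mulmxDl -scalemxAl vcausal_part_lin u0 v0.
by rewrite scaler0 addr0.
Qed.

Definition enc_state_space : lmodType F := lmod_quot enc_null_submod.
Definition enc_class (u : 'rV[L]_k) : enc_state_space :=
  quot_class enc_null_submod (u : U).
End EncodingStateSpace.

Section CodeStateSpace.
Variables (n : nat) (C : {vspace 'rV[L]_n}).
Local Notation CF := (restrict_scalars (subvs_of C)).

(* The subspace C* of the code state space Sigma_C = C / C*. *)
Definition code_null : {pred CF} :=
  fun v : subvs_of C => vcausal_part (vsval v) \in C.

Lemma code_null_submod : submod_closed code_null.
Proof.
split; first by rewrite unfold_in /= vcausal_part0 mem0v.
move=> a u v uC vC; rewrite -[_ \in _]/(vcausal_part (vsval (a *: u + v : CF)) \in C).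
have {}uC : vcausal_part (vsval u) \in C := uC.
have {}vC : vcausal_part (vsval v) \in C := vC.
have -> : vsval (a *: u + v : CF) = a%:A *: vsval u + vsval v.
  by rewrite -[LHS]/(vsval ((a%:A : L) *: (u : subvs_of C) + (v : subvs_of C))) linearP.
by rewrite vcausal_part_lin memvD// memvZ.
Qed.

Definition code_state_space : lmodType F := lmod_quot code_null_submod.
Definition code_class (v : subvs_of C) : code_state_space :=
  quot_class code_null_submod (v : CF).
End CodeStateSpace.

Definition minimal_generating (n k : nat) (C : {vspace 'rV[L]_n}) (G : 'M[L]_(k, n)) :=
  generating C G /\
  forall G' : 'M[L]_(k, n), generating C G' ->
    dim_le (enc_state_space G) (enc_state_space G').
End Codes.

(* Main.v *)
Require Import Defs.
From HB Require Import structures.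
From mathcomp Require Import all_boot all_order all_algebra.
From mathcomp Require Import boolp classical_sets functions cardinality.
Set Implicit Arguments.
Unset Strict Implicit.
Unset Printing Implicit Defensive.
Import GRing.Theory.
Local Open Scope ring_scope.

(** For causal [G] one has [Q(uG) = Q(P(u)G) + Q(u)G], and [Q(u)G] lies in [C];
    so [Q(P(u)G) = 0] forces [Q(uG)] into [C], which makes the map well defined.
    It is onto because the rows of [G] span [C]. Lifting a basis of the target
    along a linear surjection and completing it by Zorn's lemma bounds
    [dim Sigma_C] by [dim Sigma_G'] for every generating matrix [G']; if the map
    of [G] is injective, the same lifting bounds [dim Sigma_G]. *)

Section LinearIndependence.
Variable K : fieldType.

(** Applying [g] to a relation among the [t v] gives the same relation among the [f v], and
    injectivity of [f] pulls it back to [B]. So [t] can be a bare choice of preimages. *)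
Lemma lin_indep_lift (V W Z : lmodType K) (f : {linear V -> Z})
    (g : {linear W -> Z}) (t : V -> W) (B : set V) :
  injective f -> (forall v, g (t v) = f v) -> lin_indep B ->
  lin_indep (t @` B)%classic.
Proof.
move=> f_inj gt B_indep s c s_uniq sB s0.
have t_inj : injective t by move=> x y /(congr1 g); rewrite !gt => /f_inj.
have [s' s'B def_s] : exists2 s', forall v, v \in s' -> B v & s = map t s'.
  elim: s sB {s_uniq s0} => [|w s IH] sB; first by exists [::].
  have [|s' s'B ->] := IH; first by move=> v vs; apply: sB; rewrite inE vs orbT.
  have [v Bv <-] : (t @` B)%classic w by apply: sB; rewrite mem_head.
  by exists (v :: s') => // x; rewrite inE => /predU1P[->|/s'B].
rewrite def_s (map_inj_uniq t_inj) in s_uniq s0 *.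
rewrite big_map in s0.
have {}s0 : \sum_(v <- s') (c \o t) v *: v = 0.
  apply: f_inj; rewrite linear0 -(linear0 g) -s0 !linear_sum.
  by apply: eq_bigr => v _; rewrite !linearZ /= gt.
by move=> _ /mapP[v vs' ->]; apply: (B_indep _ _ s_uniq s'B s0 v vs').
Qed.

(** A nontrivial relation in [B] with [w] added must have a nonzero coefficient at [w], so it can be
    solved for [w]. *)
Lemma maximal_lin_indep_spanning (V : lmodType K) (B : set V) : lin_indep B ->
  (forall w, ~ B w -> ~ lin_indep (B `|` [set w])%classic) -> spanning B.
Proof.
move=> B_indep B_max w.
have [Bw|nBw] := pselect (B w).
  exists [:: w], (fun=> 1); rewrite big_seq1 scale1r; split=> // v.
  by rewrite inE => /eqP->.
have /existsNP[s /existsNP[c]] := B_max w nBw.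
move=> /not_implyP[s_uniq /not_implyP[sB /not_implyP[s0 /existsNP[x]]]].
move=> /not_implyP[xs /eqP cx].
have remB v : v \in rem w s -> B v.
  rewrite mem_rem_uniq// inE => /andP[/= vw vs].
  by have [//|/= vw'] := sB v vs; rewrite vw' eqxx in vw.
have [ws|nws] := boolP (w \in s); last first.
  case/eqP: cx; apply: (B_indep s c) => // v vs.
  by have [//|/= vw] := sB v vs; rewrite -vw vs in nws.
rewrite (big_rem w)//= in s0.
(* Otherwise the witness [x] of nontriviality differs from [w], and dropping [w] leaves a nontrivial
   relation inside [B]. *)
have cw : c w != 0.
  apply: contra_neq cx => cw; have [->//|xw] := eqVneq x w.
  apply: (B_indep (rem w s) c) => //; first exact: rem_uniq.
    by move: s0; rewrite cw scale0r add0r.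
  by rewrite mem_rem_uniq// inE xw.
exists (rem w s), (fun v => - (c w)^-1 * c v); split=> //.
apply: (scalerI cw); rewrite scaler_sumr.
under eq_bigr do rewrite scalerA mulrA mulrN mulfV// mulN1r scaleNr.
by rewrite sumrN; apply/eqP; rewrite -addr_eq0 s0.
Qed.

Lemma lin_indep_extend (V : lmodType K) (B : set V) : lin_indep B ->
  exists2 B' : set V, is_basis B' & (B `<=` B')%classic.
Proof.
move=> B_indep.
(* Zorn is applied to the sets [A] to be joined to [B], rather than to supersets of [B]: the union
   of the empty chain is then admissible. *)
have [A [A_indep A_max]] : exists A : set V,
    lin_indep (A `|` B)%classic /\
    forall A' : set V, (A `<` A')%classic -> ~ lin_indep (A' `|` B)%classic.
  apply: (@Zorn_bigcup V (fun A => lin_indep (A `|` B)%classic)) => Ch ChP Ch_tot.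
  move=> s c s_uniq sCh.
  have [A A_indep sA] : exists2 A : set V, lin_indep (A `|` B)%classic &
      forall v, v \in s -> (A `|` B)%classic v.
    (* A finite list lies in a single member of the chain together with [B]; [set0] starts the
       induction, as the chain may be empty. *)
    suff [A [-> | /ChP ?] sA] : exists2 A : set V, A = set0 \/ Ch A &
        forall v, v \in s -> (A `|` B)%classic v.
      - by exists set0; rewrite ?set0U// => v /sA; rewrite set0U.
      - by exists A.
    elim: s sCh {s_uniq} => [|w s IH] sCh; first by exists set0; [left|].
    have [|A A_Ch sA] := IH; first by move=> v vs; apply: sCh; rewrite inE vs orbT.
    have [[A' /= ChA' A'w]|Bw] := sCh w (mem_head _ _); last first.
      by exists A => // v; rewrite inE => /predU1P[->|/sA//]; right.
    have [AA'|A'A] : (A `<=` A')%classic \/ (A' `<=` A)%classic.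
      by case: A_Ch => [-> | ChA]; [left | exact: Ch_tot].
    - exists A'; first by right.
      by move=> v; rewrite inE => /predU1P[->|/sA[/AA'|]]; [left|left|right].
    - by exists A => // v; rewrite inE => /predU1P[->|/sA//]; left; apply: A'A.
  exact: A_indep.
exists (A `|` B)%classic; last exact: subsetUr.
split=> //; apply: maximal_lin_indep_spanning => // w nABw.
(* The new vector [w] is moved next to [A], which it enlarges strictly. *)
rewrite setUAC; apply: A_max; split; first exact: subsetUl.
by move=> /(_ w) Aw; apply: nABw; left; apply: Aw; right.
Qed.

(** Preimages under [g] of the [f]-images of a basis of [V] are independent in [W], hence extend to
    a basis. Keeping [f] general serves both the dimension bound ([f] the identity) and minimality
    ([f] the state map). *)
Lemma dim_le_lift (V W Z : lmodType K) (f : {linear V -> Z}) (g : {linear W -> Z}) :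
  injective f -> (forall z, exists w, g w = z) -> dim_le V W.
Proof.
move=> f_inj g_surj.
have [t gt] := choice (fun v => g_surj (f v)).
(* A basis of [V] is obtained by extending the empty family. *)
have [B B_basis _] : exists2 B : set V, is_basis B & (set0 `<=` B)%classic.
  by apply: lin_indep_extend => s c _ s0 _ v /s0.
have [B' B'_basis tBB'] := lin_indep_extend (lin_indep_lift f_inj gt B_basis.1).
exists B, B'; split=> //; apply: card_le_trans (subset_card_le tBB').
rewrite (card_le_eqr (inj_card_eq _)) //.
by move=> x y _ _ /(congr1 g); rewrite !gt => /f_inj.
Qed.

Lemma dim_le_surj (W Z : lmodType K) (g : {linear W -> Z}) :
  (forall z, exists w, g w = z) -> dim_le Z W.
Proof. exact: (@dim_le_lift Z W Z idfun). Qed.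

End LinearIndependence.

Lemma quot_lift (R : nzRingType) (V W : lmodType R) (S : {pred V})
    (S_submod : submod_closed S) (f : V -> W) :
  linear f -> (forall v, v \in S -> f v = 0) ->
  exists g : {linear lmod_quot S_submod -> W},
    forall v, g (quot_class S_submod v) = f v.
Proof.
move=> f_lin f0.
pose g (x : lmod_quot S_submod) : W := f (generic_quotient.repr x).
have f_sub u v : f (u - v) = f u - f v.
  by rewrite addrC -scaleN1r f_lin scaleN1r addrC.
have gE v : g (quot_class S_submod v) = f v.
  apply/eqP; rewrite -subr_eq0 -f_sub; apply/eqP/f0.
  by apply/(quot_class_eq S_submod); exact: generic_quotient.reprK.
have g_lin : linear g.
  move=> a x y; have [u <-] := quot_class_surj x; have [v <-] := quot_class_surj y.
  by rewrite -linearP !gE f_lin.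
pose gL := GRing.isLinear.Build R (lmod_quot S_submod) W *:%R g g_lin.
pose h : {linear lmod_quot S_submod -> W} := HB.pack g gL.
by exists h.
Qed.

Section CausalPart.
Variable F : fieldType.
Local Notation L := (laurent F).

Lemma causalM (u v : L) : causal u -> causal v -> causal (u * v).
Proof.
move=> u0 v0 j j0; rewrite -[LHS]/(conv u v j).
by apply: (conv_low u0 v0); rewrite addr0.
Qed.

Lemma causal_sum (I : finType) (u : I -> L) :
  (forall i, causal (u i)) -> causal (\sum_i u i).
Proof.
move=> u0; elim/big_ind: _ => // x y x0 y0 j j0.
by rewrite lcoefD x0// y0// addr0.
Qed.

Lemma causal_causal_part (u : L) : causal (causal_part u).
Proof. by move=> j j0; rewrite /= Order.TotalTheory.leNgt j0. Qed.

Lemma causal_part_id (u : L) : causal u -> causal_part u = u.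
Proof.
move=> u0; apply: laurentP => j /=.
by case: Order.TotalTheory.leP => // /u0->.
Qed.

Lemma add_causal_anticausal_part (u : L) : anticausal_part u + causal_part u = u.
Proof.
apply: laurentP => j; rewrite lcoefD /=.
by case: Order.TotalTheory.leP; rewrite ?addr0 ?add0r.
Qed.

Lemma vcausal_partD n (u v : 'rV[L]_n) :
  vcausal_part (u + v) = vcausal_part u + vcausal_part v.
Proof. by have := vcausal_part_lin 1 u v; rewrite !scale1r. Qed.

(** Products and sums of causal series are causal, so taking causal parts fixes
    [vcausal_part u *m G]. *)
Lemma vcausal_part_mulmx n k (G : 'M[L]_(k, n)) (u : 'rV[L]_k) :
  (forall i j, causal (G i j)) ->
  vcausal_part (u *m G) =
    vcausal_part (vanticausal_part u *m G) + vcausal_part u *m G.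
Proof.
move=> G0.
have {1}-> : u = vanticausal_part u + vcausal_part u.
  by apply/rowP => i; rewrite !mxE add_causal_anticausal_part.
rewrite mulmxDl vcausal_partD; congr (_ + _).
apply/rowP => j; rewrite [LHS]mxE causal_part_id// mxE.
apply: causal_sum => i; apply: causalM => //.
by rewrite mxE; apply: causal_causal_part.
Qed.

End CausalPart.

Section StateMap.
Variables (F : fieldType) (n k : nat) (C : {vspace 'rV[laurent F]_n}).
Variable G : 'M[laurent F]_(k, n).
Hypothesis HG : generating C G.

(** This form of the row span yields both that [u *m G] is a codeword and that every codeword arises
    so. *)
Lemma generating_limg : C = limg (linfun (mulmxr G)).
Proof.
have [_ _ <-] := HG; apply/eqP; rewrite eqEsubv; apply/andP; split.
  apply/span_subvP => _ /mapP[i _ ->].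
  by apply/memv_imgP; exists (delta_mx 0 i); rewrite ?memvf// lfunE /= rowE.
apply/subvP => _ /memv_imgP[u _ ->]; rewrite lfunE /= mulmx_sum_row.
by apply: memv_suml => i _; apply/memvZ/memv_span/map_f; rewrite mem_enum.
Qed.

Lemma mulmx_mem_code (u : 'rV_k) : u *m G \in C.
Proof.
by rewrite generating_limg; apply/memv_imgP; exists u; rewrite ?memvf ?lfunE.
Qed.

(** Surjectivity is recorded because it is what a competing generating matrix contributes to
    minimality. *)
Lemma state_map :
  exists calG : {linear enc_state_space G -> code_state_space C},
    (forall u : 'rV_k, calG (enc_class G u) = code_class (Subvs (mulmx_mem_code u))) /\
    (forall y, exists x, calG x = y).
Proof.
pose f (u : restrict_scalars 'rV[laurent F]_k) := code_class (Subvs (mulmx_mem_code u)).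
have f_lin : linear f.
  move=> a u v; rewrite /f /code_class -linearP; congr quot_class.
  by apply: val_inj; rewrite /= scalemxAl -mulmxDl.
have [|calG calGE] := @quot_lift _ _ _ _ (enc_null_submod G) f f_lin.
  move=> u /eqP u0; rewrite /f /code_class -(raddf0 (quot_class (code_null_submod C))).
  apply/quot_class_eq; rewrite subr0.
  rewrite -[_ \in _]/(vcausal_part (u *m G) \in C) vcausal_part_mulmx.
    by rewrite u0 add0r mulmx_mem_code.
  by move=> i j; have [_ /(_ i j)[]] := HG.
exists calG; split=> // y; have [v <-] := quot_class_surj y.
have: vsval v \in limg (linfun (mulmxr G)) by rewrite -generating_limg subvsP.
move=> /memv_imgP[u _].
rewrite lfunE /= => vu; exists (enc_class G u).
by rewrite calGE; congr quot_class; apply: val_inj; rewrite /= vu.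
Qed.

End StateMap.

Theorem mainTheorem2 (F : finFieldType) (n k : nat)
    (C : {vspace 'rV[laurent F]_n}) (G : 'M[laurent F]_(k, n))
    (HC : is_conv_code k C) (HG : generating C G) :
  exists (uGC : forall u : 'rV[laurent F]_k, u *m G \in C)
         (calG : {linear enc_state_space G -> code_state_space C}),
    [/\ forall u : 'rV[laurent F]_k,
          calG (enc_class G u) = code_class (Subvs (uGC u)),
        dim_le (code_state_space C) (enc_state_space G) &
        injective calG -> minimal_generating C G].
Proof.
have [calG [calGE calG_surj]] := state_map HG.
exists (mulmx_mem_code HG), calG; split=> //; first exact: dim_le_surj calG_surj.
move=> calG_inj; split=> // G' /state_map[calG' [_ calG'_surj]].
(* Both encoding state spaces map to the same code state space: that of [G] injectively, that of
   [G'] onto it. *)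
exact: dim_le_lift calG_inj calG'_surj.
Qed.
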